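(* Let $\Pi$ be a convex polyhedron with vertices $1,\ldots,m$ and faces $1,\ldots,n$, let $c_1,\ldots,c_m$, $d_1,\ldots,d_n$ be a polyhedral configuration for $\Pi$, let $C$ be the $4\times m$ matrix with columns $\mathbf{c}_1,\ldots,\mathbf{c}_m$ (augmented curvature-center coordinates), let $\tilde C$ be any $m\times 4$ matrix with $C\tilde C=I_4$, and set $\tilde G=\tilde C P^{-1}\tilde C^T$. Then every Descartes tuple $\mathbf{b}=(b_1,\ldots,b_m)^T$ of the polyhedral packing $\mathcal{P}$ generated by this configuration satisfies $\mathbf{b}^T\tilde G\mathbf{b}=0$.
   Context: Augmented curvature-center coordinates: an oriented generalized circle is represented by $\mathbf{c}=(\tilde b,b,h_1,h_2)^T\in\mathbb{R}^4$, where $b$ is its signed curvature, $\tilde b$ the curvature of its image under inversion in the unit circle, $(h_1,h_2)$ equals $b$ times the center (for a line, $b=0$ and $(h_1,h_2)$ is the unit normal); circles are oriented with inward normal if $b>0$, outward if $b<0$, the interior being the side the normal points to. Let $P$ be the symmetric matrix $\begin{pmatrix}0&-\tfrac12&0&0\\-\tfrac12&0&0&0\\0&0&1&0\\0&0&0&1\end{pmatrix}$. A polyhedral configuration for $\Pi$: oriented circles $c_1,\ldots,c_m$ (one per vertex) with pairwise disjoint interiors, $c_i,c_k$ tangent iff vertices $i,k$ are adjacent (disjoint otherwise); oriented dual circles $d_1,\ldots,d_n$ (one per face) with pairwise disjoint interiors, tangent iff the faces share an edge (disjoint otherwise); $c_i$ orthogonal to $d_j$ if vertex $i$ lies on face $j$,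 disjoint otherwise. Let $W_{\mathrm{geom}}$ be the group of Möbius transformations generated by the inversions in $d_1,\ldots,d_n$. The polyhedral packing $\mathcal{P}$ is the collection of $m$-tuples of circles $(g c_1,\ldots,g c_m)$, $g\in W_{\mathrm{geom}}$; a Descartes tuple of $\mathcal{P}$ is the vector $(b_1,\ldots,b_m)$ of curvatures of such a tuple. *)

(* Defs.v *)
From mathcomp Require Import all_boot all_order all_algebra.
From mathcomp Require Import all_classical all_reals.

Set Implicit Arguments.
Unset Strict Implicit.
Unset Printing Implicit Defensive.

Import Order.TTheory GRing.Theory Num.Theory.

Local Open Scope classical_set_scope.
Local Open Scope ring_scope.

Definition dotv (R : realType) (k : nat) (u v : 'rV[R]_k) : R :=
  \sum_(i < k) u 0 i * v 0 i.

Definition normsq (R : realType) (k : nat) (u : 'rV[R]_k) : R := dotv u u.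

(* Homogeneous coordinates: the rank is 1 + the dimension of the affine span
   of the points v i, i in S. *)
Definition aff_rank (R : realType) (m : nat) (v : 'I_m -> 'rV[R]_3)
    (S : {set 'I_m}) : nat :=
  \rank (\matrix_(i < m) (if i \in S then row_mx (v i) (1 : 'rV[R]_1) else 0)).

(* A face of the convex hull of the points v i is encoded by the set of labels
   of the vertices lying on it.
   The degenerate choices a = 0 only add S = set0 and S = setT, which are told
   apart from vertices, edges and facets by their affine rank. *)
Definition is_face (R : realType) (m : nat) (v : 'I_m -> 'rV[R]_3)
    (S : {set 'I_m}) : Prop :=
  exists (a : 'rV[R]_3) (beta : R),
    (forall k, dotv a (v k) <= beta) /\
    (forall k, k \in S <-> dotv a (v k) = beta).

Definition is_edge (R : realType) (m : nat) (v : 'I_m -> 'rV[R]_3)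
    (S : {set 'I_m}) : Prop :=
  is_face v S /\ aff_rank v S = 2%N.

Definition is_facet (R : realType) (m : nat) (v : 'I_m -> 'rV[R]_3)
    (S : {set 'I_m}) : Prop :=
  is_face v S /\ aff_rank v S = 3%N.

Record polyhedron (R : realType) (m n : nat) := Polyhedron {
  vtx : 'I_m -> 'rV[R]_3;
  fac : 'I_n -> {set 'I_m};
  vtx_spanning : aff_rank vtx [set: 'I_m]%SET = 4%N;
  (* every point is an extreme point of the hull; in particular the points are
     pairwise distinct *)
  vtx_extreme : forall i, is_face vtx [set i]%SET;
  fac_inj : injective fac;
  facP : forall S, is_facet vtx S <-> exists j, fac j = S
}.

Definition vtx_adjacent (R : realType) (m n : nat) (Pi : polyhedron R m n)
    (i k : 'I_m) : Prop :=
  i != k /\ is_edge (vtx Pi) [set i; k]%SET.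

Definition fac_adjacent (R : realType) (m n : nat) (Pi : polyhedron R m n)
    (j l : 'I_n) : Prop :=
  j != l /\
  exists2 S, is_edge (vtx Pi) S & (S \subset fac Pi j) && (S \subset fac Pi l).

(* The extended plane; None is the point at infinity. *)
Definition xplane (R : realType) := option 'rV[R]_2.

(* [Circle z b] has centre z and signed curvature b, hence radius |b|^-1;
   [Line u p] is the line u . w = p with unit normal u. *)
Inductive ocircle (R : realType) :=
  | Circle (z : 'rV[R]_2) (b : R) of b != 0
  | Line (u : 'rV[R]_2) (p : R) of normsq u == 1.

Definition curvature (R : realType) (c : ocircle R) : R :=
  match c with Circle _ b _ => b | Line _ _ _ => 0 end.

Definition curvature_center (R : realType) (c : ocircle R) : 'rV[R]_2 :=
  match c with Circle z b _ => b *: z | Line u _ _ => u end.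

Definition locus (R : realType) (c : ocircle R) : set (xplane R) :=
  match c with
  | Circle z b _ =>
      [set x | if x is Some w then normsq (w - z) = b ^- 2 else False]
  | Line u p _ =>
      [set x | if x is Some w then dotv u w = p else True]
  end.

(* The side the normal points to: the disc if b > 0, and the complement of the
   closed disc, including infinity, if b < 0. *)
Definition inside (R : realType) (c : ocircle R) : set (xplane R) :=
  match c with
  | Circle z b _ =>
      if 0 < b then
        [set x | if x is Some w then normsq (w - z) < b ^- 2 else False]
      else
        [set x | if x is Some w then b ^- 2 < normsq (w - z) else True]
  | Line u p _ =>
      [set x | if x is Some w then p < dotv u w else False]
  end.

(* Tangency and disjointness are those of the curves in the extended plane, so
   parallel lines are tangent at infinity and crossing lines meet twice. *)
Definition tangent (R : realType) (c c' : ocircle R) : Prop :=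
  exists x, locus c `&` locus c' = [set x].

Definition disjoint_circles (R : realType) (c c' : ocircle R) : Prop :=
  locus c `&` locus c' = set0.

Definition disjoint_insides (R : realType) (c c' : ocircle R) : Prop :=
  inside c `&` inside c' = set0.

(* A normal vector at the point w of c, up to a nonzero scalar. *)
Definition normal_at (R : realType) (c : ocircle R) (w : 'rV[R]_2) : 'rV[R]_2 :=
  match c with Circle z _ _ => w - z | Line u _ _ => u end.

(* Two orthogonal generalized circles always have a finite common point. *)
Definition orthogonal_circles (R : realType) (c c' : ocircle R) : Prop :=
  (exists w, locus c (Some w) /\ locus c' (Some w)) /\
  (forall w, locus c (Some w) -> locus c' (Some w) ->
     dotv (normal_at c w) (normal_at c' w) = 0).

(* Reflection when the generalized circle is a line. *)
Definition inversion (R : realType) (c : ocircle R) (x : xplane R) : xplane R :=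
  match c, x with
  | Circle z _ _, None => Some z
  | Circle z b _, Some w =>
      if w == z then None
      else Some (z + (b ^- 2 / normsq (w - z)) *: (w - z))
  | Line _ _ _, None => None
  | Line u p _, Some w => Some (w - (2 * (dotv u w - p)) *: u)
  end.

(* c' = g c as oriented circles; such a c' is determined by g and c. *)
Definition is_image (R : realType) (g : xplane R -> xplane R)
    (c c' : ocircle R) : Prop :=
  locus c' = g @` locus c /\ inside c' = g @` inside c.

Inductive generated (T : Type) (S : set (T -> T)) : (T -> T) -> Prop :=
  | generated_base g : S g -> generated S g
  | generated_id : generated S id
  | generated_comp f g : generated S f -> generated S g -> generated S (f \o g)
  | generated_inv f g :
      generated S f -> cancel f g -> cancel g f -> generated S g.

Definition W_geom (R : realType) (n : nat) (d : 'I_n -> ocircle R) :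
    set (xplane R -> xplane R) :=
  generated [set g | exists j, g = inversion (d j)].

Definition unit_circle (R : realType) : ocircle R :=
  Circle (0 : 'rV[R]_2) (oner_neq0 R).

Definition aug_coords (R : realType) (c : ocircle R) (v : 'cV[R]_4) : Prop :=
  [/\ exists2 c', is_image (inversion (unit_circle R)) c c'
                & v (inord 0) 0 = curvature c',
      v (inord 1) 0 = curvature c,
      v (inord 2) 0 = curvature_center c 0 (inord 0)
    & v (inord 3) 0 = curvature_center c 0 (inord 1)].

Definition Pmx (R : realType) : 'M[R]_4 :=
  \matrix_(i < 4, j < 4)
    nth 0 (nth [::] [:: [::      0; - 2^-1; 0; 0];
                        [:: - 2^-1;      0; 0; 0];
                        [::      0;      0; 1; 0];
                        [::      0;      0; 0; 1]] i) j.

Definition Gtilde (R : realType) (m : nat) (Ct : 'M[R]_(m, 4)) : 'M[R]_m :=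
  Ct *m invmx (Pmx R) *m Ct^T.

Record polyhedral_configuration (R : realType) (m n : nat)
    (Pi : polyhedron R m n) (c : 'I_m -> ocircle R) (d : 'I_n -> ocircle R) :
    Prop := PolyhedralConfiguration {
  c_insides : forall i k, i != k -> disjoint_insides (c i) (c k);
  c_tangent : forall i k, i != k ->
    (tangent (c i) (c k) <-> vtx_adjacent Pi i k);
  c_disjoint : forall i k, i != k ->
    ~ vtx_adjacent Pi i k -> disjoint_circles (c i) (c k);
  d_insides : forall j l, j != l -> disjoint_insides (d j) (d l);
  d_tangent : forall j l, j != l ->
    (tangent (d j) (d l) <-> fac_adjacent Pi j l);
  d_disjoint : forall j l, j != l ->
    ~ fac_adjacent Pi j l -> disjoint_circles (d j) (d l);
  cd_orthogonal : forall i j, i \in fac Pi j ->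
    orthogonal_circles (c i) (d j);
  cd_disjoint : forall i j, i \notin fac Pi j ->
    disjoint_circles (c i) (d j)
}.

Definition packing (R : realType) (m n : nat)
    (c : 'I_m -> ocircle R) (d : 'I_n -> ocircle R) : set ('I_m -> ocircle R) :=
  [set t | exists2 g, W_geom d g & forall i, is_image g (c i) (t i)].

Definition descartes_tuple (R : realType) (m n : nat)
    (c : 'I_m -> ocircle R) (d : 'I_n -> ocircle R) (b : 'cV[R]_m) : Prop :=
  exists2 t, packing c d t & b = \col_(i < m) curvature (t i).

(* Main.v *)
(* In augmented curvature-center coordinates an oriented circle is a unit vector
   of the Lorentzian form P, and a point w of the plane is the null vector
   (|w|^2, 1, w); infinity is (1, 0, 0, 0). A point lies inside, on or outside a
   circle according to the sign of the product of the two vectors. The inversion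
   in d lifts, up to positive scalars on null vectors, to the reflection in the
   vector of d, so each g in W_geom acts on circles by a matrix M with
   M^T P M = P. A Descartes tuple is then b^T = e^T M C, where e^T extracts the
   curvature, and b^T Gtilde b = e^T M P^-1 M^T e = e^T P^-1 e = 0. *)
Require Import Defs.
From mathcomp Require Import all_boot all_order all_algebra.
From mathcomp Require Import all_classical all_reals.
From mathcomp Require Import ring lra.

Set Implicit Arguments.
Unset Strict Implicit.
Unset Printing Implicit Defensive.

Import Order.TTheory GRing.Theory Num.Theory.

Local Open Scope ring_scope.

Section Lorentz.
Variable R : realType.
Implicit Types (u v : 'cV[R]_4) (w z : 'rV[R]_2) (x : xplane R) (c : ocircle R).

(** * Coordinates and the Lorentzian form *)

Lemma sum_inord4 (V : nmodType) (F : 'I_4 -> V) :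
  \sum_(i < 4) F i = F (inord 0) + F (inord 1) + F (inord 2) + F (inord 3).
Proof.
rewrite !big_ord_recl big_ord0 addr0 !addrA.
by congr (F _ + F _ + F _ + F _); apply: val_inj; rewrite /= inordK.
Qed.

Lemma ord4_ind (Q : 'I_4 -> Prop) :
  Q (inord 0) -> Q (inord 1) -> Q (inord 2) -> Q (inord 3) -> forall i, Q i.
Proof.
move=> q0 q1 q2 q3 i; rewrite -(inord_val i).
by case: i => [[|[|[|[|//]]]]].
Qed.

Definition vec4 (a0 a1 a2 a3 : R) : 'cV[R]_4 :=
  \col_(i < 4) nth 0 [:: a0; a1; a2; a3] i.

Lemma vec4E a0 a1 a2 a3 :
  ((vec4 a0 a1 a2 a3 (inord 0) 0 = a0) * (vec4 a0 a1 a2 a3 (inord 1) 0 = a1) *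
   (vec4 a0 a1 a2 a3 (inord 2) 0 = a2) * (vec4 a0 a1 a2 a3 (inord 3) 0 = a3))%type.
Proof. by rewrite !mxE !inordK. Qed.

Definition form u v : R := (u^T *m Pmx R *m v) 0 0.

Lemma formE u v : form u v =
  u (inord 2) 0 * v (inord 2) 0 + u (inord 3) 0 * v (inord 3) 0
  - (u (inord 0) 0 * v (inord 1) 0 + u (inord 1) 0 * v (inord 0) 0) / 2.
Proof.
rewrite /form mxE sum_inord4 !mxE !sum_inord4 !mxE !inordK //=.
by field.
Qed.

Lemma dotvE (u v : 'rV[R]_2) :
  dotv u v = u 0 (inord 0) * v 0 (inord 0) + u 0 (inord 1) * v 0 (inord 1).
Proof.
rewrite /dotv !big_ord_recl big_ord0 addr0.
by congr (u _ _ * v _ _ + u _ _ * v _ _); apply: val_inj; rewrite /= inordK.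
Qed.

Lemma rV2_eq0 w : (w == 0) = (normsq w == 0).
Proof.
apply/eqP/eqP => [->|]; first by rewrite /normsq dotvE !mxE !mul0r addr0.
rewrite /normsq dotvE -!expr2 => /eqP.
rewrite paddr_eq0 ?sqr_ge0 // !sqrf_eq0 => /andP[/eqP w0 /eqP w1].
apply/rowP => i; rewrite mxE -(inord_val i).
by case: i => [[|[|//]]].
Qed.

(** * Vectors of circles and points *)

(** The first entry is the curvature after inversion in the unit circle, in closed form;
    [aug_coordsE] confirms this. *)
Definition circle_vec c : 'cV[R]_4 :=
  let h := curvature_center c in
  vec4 (match c with
        | Circle z b _ => b * (normsq z - b ^- 2)
        | Line _ p _ => 2 * p
        end)
    (curvature c) (h 0 (inord 0)) (h 0 (inord 1)).

Definition point_vec x : 'cV[R]_4 :=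
  if x is Some w then vec4 (normsq w) 1 (w 0 (inord 0)) (w 0 (inord 1))
  else vec4 1 0 0 0.

Lemma form_circle_circle c : form (circle_vec c) (circle_vec c) = 1.
Proof.
rewrite formE !vec4E; case: c => [z b b0|u p /= /eqP]; rewrite /= ?mxE /normsq dotvE.
- by field.
- by move=> <-; ring.
Qed.

Lemma form_circle_finite z b (b0 : b != 0) w :
  form (circle_vec (Circle z b0)) (point_vec (Some w)) =
  b * (b ^- 2 - normsq (w - z)) / 2.
Proof. by rewrite formE !vec4E /= !mxE /normsq !dotvE !mxE; field. Qed.

Lemma form_infty v : form v (point_vec None) = - v (inord 1) 0 / 2.
Proof. by rewrite formE !vec4E; field. Qed.

Lemma form_line_finite (u : 'rV[R]_2) p (hu : normsq u == 1) w :
  form (circle_vec (Line p hu)) (point_vec (Some w)) = dotv u w - p.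
Proof. by rewrite formE !vec4E /= dotvE; field. Qed.

Lemma locus_form c x :
  locus c x <-> form (circle_vec c) (point_vec x) = 0.
Proof.
case: c x => [z b b0|u p hu] [w|].
- rewrite form_circle_finite /=; split=> [->|/eqP].
    by rewrite subrr mulr0 mul0r.
  rewrite !mulf_eq0 (negPf b0) invr_eq0 pnatr_eq0 orbF /= subr_eq0.
  by move=> /eqP ->.
- rewrite form_infty vec4E /=; split=> // /eqP.
  by rewrite mulf_eq0 oppr_eq0 (negPf b0) invr_eq0 pnatr_eq0.
- by rewrite form_line_finite /=; split=> [->|/eqP]; rewrite ?subrr ?subr_eq0 // => /eqP.
- by rewrite form_infty vec4E /= oppr0 mul0r.
Qed.

Lemma inside_form c x :
  inside c x <-> 0 < form (circle_vec c) (point_vec x).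
Proof.
case: c x => [z b b0|u p hu] [w|].
- rewrite form_circle_finite /= pmulr_lgt0 ?invr_gt0 //.
  case: ltP => [bp|bn] /=; first by rewrite pmulr_rgt0 // subr_gt0.
  by rewrite nmulr_rgt0 ?subr_lt0 // lt_neqAle b0.
- rewrite form_infty vec4E /= pmulr_lgt0 ?invr_gt0 // oppr_gt0.
  by case: ltP => [bp|bn] /=; split=> //; rewrite ?lt_neqAle ?b0 //= leNgt bp.
- by rewrite form_line_finite /= subr_gt0.
- by rewrite form_infty vec4E /= oppr0 mul0r ltxx.
Qed.

(** * Isometries of the form *)

(** The scalar may vary with [x], since [M] need not respect the normalization of [point_vec]; its
    positivity preserves the sign that separates inside from outside. *)
Definition lifts_to (g : xplane R -> xplane R) (M : 'M[R]_4) : Prop :=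
  M^T *m Pmx R *m M = Pmx R /\
  forall x, exists2 l : R, 0 < l & point_vec (g x) = l *: (M *m point_vec x).

Lemma form_isometry (M : 'M[R]_4) u v :
  M^T *m Pmx R *m M = Pmx R -> form (M *m u) (M *m v) = form u v.
Proof.
move=> hM; rewrite /form trmx_mul -!mulmxA (mulmxA (Pmx R)) (mulmxA M^T).
by rewrite (mulmxA M^T) hM.
Qed.

Lemma formZr u v l : form u (l *: v) = l * form u v.
Proof. by rewrite /form -scalemxAr mxE. Qed.

Definition Pinv : 'M[R]_4 :=
  \matrix_(i < 4, j < 4)
    nth 0 (nth [::] [:: [::   0; - 2; 0; 0];
                        [:: - 2;   0; 0; 0];
                        [::   0;   0; 1; 0];
                        [::   0;   0; 0; 1]] i) j.

Lemma mul_Pmx_Pinv : Pmx R *m Pinv = 1%:M.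
Proof.
apply/matrixP => i j; rewrite !mxE sum_inord4 !mxE !inordK //=.
elim/ord4_ind: i; elim/ord4_ind: j; rewrite -val_eqE /= !inordK //=; by field.
Qed.

Lemma Pmx_unit : Pmx R \in unitmx.
Proof. by have [] := mulmx1_unit mul_Pmx_Pinv. Qed.

Lemma invmx_Pmx : invmx (Pmx R) = Pinv.
Proof. by rewrite -[LHS]mulmx1 -mul_Pmx_Pinv mulKmx // Pmx_unit. Qed.

Lemma Pmx_sym : (Pmx R)^T = Pmx R.
Proof.
apply/matrixP => i j; rewrite !mxE.
by elim/ord4_ind: i; elim/ord4_ind: j; rewrite !inordK.
Qed.

Lemma isometry_left_inverse (M : 'M[R]_4) :
  M^T *m Pmx R *m M = Pmx R -> Pinv *m M^T *m Pmx R *m M = 1%:M.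
Proof.
by move=> hM; rewrite -!mulmxA (mulmxA M^T) hM -invmx_Pmx mulVmx // Pmx_unit.
Qed.

(** The left inverse [Pinv *m M^T *m Pmx R] of the square matrix [M] is also a right inverse;
    multiplying by [Pinv] on the right removes [Pmx R]. *)
Lemma isometry_Pinv (M : 'M[R]_4) :
  M^T *m Pmx R *m M = Pmx R -> M *m Pinv *m M^T = Pinv.
Proof.
move=> /isometry_left_inverse /mulmx1C hM.
rewrite -[LHS]mulmx1 -{1}mul_Pmx_Pinv !mulmxA.
by rewrite !mulmxA in hM; rewrite hM mul1mx.
Qed.

(** * Reflections as lifts of inversions *)

Definition reflection v : 'M[R]_4 := 1%:M - 2 *: (v *m (v^T *m Pmx R)).

Lemma reflectionE v u : reflection v *m u = u - (2 * form v u) *: v.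
Proof.
rewrite /reflection mulmxBl mul1mx -scalemxAl -mulmxA.
by rewrite [v^T *m _ *m u]mx11_scalar mul_mx_scalar scalerA.
Qed.

Lemma reflection_isometry v :
  form v v = 1 -> (reflection v)^T *m Pmx R *m reflection v = Pmx R.
Proof.
move=> hv.
have vPv : v^T *m (Pmx R *m v) = 1%:M.
  by rewrite mulmxA [LHS]mx11_scalar -/(form v v) hv.
set A := Pmx R *m v *m v^T *m Pmx R.
have PM : Pmx R *m reflection v = Pmx R - 2 *: A.
  by rewrite mulmxBr mulmx1 -scalemxAr !mulmxA.
have trM : (reflection v)^T = 1%:M - 2 *: (Pmx R *m v *m v^T).
  by rewrite raddfB /= trmx1 linearZ /= !trmx_mul trmxK Pmx_sym.
(* As [form v v = 1], the quadratic term of the expansion is [4 *: A], which cancels the two linear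
   terms [- 2 *: A]. *)
have PvvA : Pmx R *m v *m v^T *m A = A.
  rewrite /A -!mulmxA; do 2 congr (_ *m _).
  by rewrite !mulmxA -(mulmxA v^T) vPv mul1mx.
rewrite -mulmxA PM trM mulmxBr mulmxBl mul1mx -!scalemxAl -scalemxAr.
rewrite mulmxBl mul1mx -scalemxAl PvvA -/A.
by apply/matrixP => i j; rewrite !mxE; ring.
Qed.

(** The scalars are forced by normalization: they make the second entry of a finite image, or the
    first entry of infinity, equal to 1. *)
Lemma inversion_lifts c : lifts_to (inversion c) (reflection (circle_vec c)).
Proof.
split=> [|x]; first exact/reflection_isometry/form_circle_circle.
rewrite reflectionE; case: c x => [z b b0|u p hu] [w|].
- rewrite form_circle_finite /=; case: eqVneq => [->|wz].
    exists (b ^+ 2); first by rewrite exprn_even_gt0.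
    apply/colP; elim/ord4_ind; rewrite !mxE !inordK //= subrr /normsq ?dotvE ?mxE;
      by field.
  have rho0 : normsq (w - z) != 0 by rewrite -rV2_eq0 subr_eq0.
  have rhop : 0 < normsq (w - z).
    by rewrite lt0r rho0 /normsq dotvE -!expr2 addr_ge0 ?sqr_ge0.
  exists (b ^+ 2 * normsq (w - z))^-1.
    by rewrite invr_gt0 mulr_gt0 // exprn_even_gt0.
  move: rho0; rewrite /normsq !dotvE !mxE => rho0.
  apply/colP; elim/ord4_ind; rewrite !mxE !inordK //= /normsq ?dotvE ?mxE;
    by field; rewrite ?b0 ?rho0.
- rewrite form_infty; exists (b ^- 2).
    by rewrite invr_gt0 exprn_even_gt0.
  by apply/colP; elim/ord4_ind; rewrite !mxE !inordK //= ?mxE; field.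
- exists 1 => //; rewrite scale1r form_line_finite.
  (* The unit normal relation is solved for one square, to serve as a rewriting rule for [ring]. *)
  have /eqP := hu; rewrite /normsq !dotvE => /(canRL (addrK _)) uu.
  apply/colP; elim/ord4_ind; rewrite !mxE !inordK //= /normsq ?dotvE ?mxE;
    by ring: uu.
- exists 1 => //; rewrite scale1r form_infty vec4E /=.
  by rewrite oppr0 mul0r mulr0 scale0r subr0.
Qed.

(** * Lifting the group generated by the inversions *)

Lemma id_lifts : lifts_to id 1%:M.
Proof.
split; first by rewrite trmx1 mul1mx mulmx1.
by move=> x; exists 1; rewrite // mul1mx scale1r.
Qed.

Lemma comp_lifts f g M N :
  lifts_to f M -> lifts_to g N -> lifts_to (f \o g) (M *m N).
Proof.
move=> [hM fM] [hN gN]; split.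
  by rewrite trmx_mul -!mulmxA (mulmxA (Pmx R)) (mulmxA M^T) (mulmxA M^T) hM mulmxA.
move=> x /=; have [l l0 ->] := fM (g x); have [k k0 ->] := gN x.
by exists (l * k); rewrite ?mulr_gt0 // -scalemxAr scalerA mulmxA.
Qed.

Lemma inv_lifts f g M :
  cancel g f -> lifts_to f M -> lifts_to g (Pinv *m M^T *m Pmx R).
Proof.
move=> gK [hM fM].
(* From here on [N] is only known as the inverse of [M]. *)
have VM := isometry_left_inverse hM; move: (_ *m Pmx R) VM => N VM.
have MV := mulmx1C VM; split.
  have trMV : N^T *m M^T = 1%:M by rewrite -trmx_mul MV trmx1.
  by rewrite -{1}hM !mulmxA trMV mul1mx -mulmxA MV mulmx1.
move=> y; have [l l0] := fM (g y); rewrite gK => ->.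
exists l^-1; first by rewrite invr_gt0.
by rewrite -scalemxAr scalerA mulVf ?gt_eqF // scale1r mulmxA VM mul1mx.
Qed.

Lemma W_geom_lifts n (d : 'I_n -> ocircle R) g :
  W_geom d g -> exists M, lifts_to g M.
Proof.
elim=> [f [j ->]||f h _ [M hM] _ [N hN]|f h _ [M hM] _ hK].
- by eexists; exact: inversion_lifts.
- by exists 1%:M; exact: id_lifts.
- by exists (M *m N); exact: comp_lifts.
- by eexists; exact: inv_lifts hK hM.
Qed.

(** * Curvatures of image circles *)

(* Four points of a circle determine the plane orthogonal to its vector, and the
   normalization leaves only a sign, which one interior point fixes. *)
Lemma curvature_unique c v :
  form v v = 1 ->
  (forall x, locus c x -> form v (point_vec x) = 0) ->
  (forall x, inside c x -> 0 < form v (point_vec x)) ->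
  curvature c = v (inord 1) 0.
Proof.
move=> hv hl hi; case: c hl hi => [z b b0|u p hu] hl hi; last first.
  (* Infinity lies on every line and forces the second entry of [v] to vanish. *)
  by have := hl None I; rewrite form_infty /=; lra.
pose pt s t : 'rV[R]_2 := z + \row_(i < 2) (if i == inord 0 then s else t).
have hpt s t : s ^+ 2 + t ^+ 2 = b ^- 2 -> form v (point_vec (Some (pt s t))) = 0.
  move=> st; apply: hl => /=; rewrite /normsq dotvE !mxE eqxx.
  by rewrite -val_eqE /= !inordK // -st /=; ring.
have r0 : b^-1 != 0 by rewrite invr_eq0.
have sqV : b^-1 ^+ 2 = b ^- 2 by rewrite exprVn.
have sqNV : (- b^-1) ^+ 2 = b ^- 2 by rewrite sqrrN.
have hE s t : form v (point_vec (Some (pt s t))) =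
    v (inord 2) 0 * (z 0 (inord 0) + s) + v (inord 3) 0 * (z 0 (inord 1) + t)
    - (v (inord 0) 0
       + v (inord 1) 0 * ((z 0 (inord 0) + s) ^+ 2 + (z 0 (inord 1) + t) ^+ 2)) / 2.
  rewrite formE !vec4E /normsq dotvE !mxE eqxx -val_eqE /= !inordK //=; by field.
(* The four points are the ends of the horizontal and vertical diameters; subtracting the equations
   of opposite ends gives [h2] and [h3]. *)
have := hpt b^-1 0; have := hpt (- b^-1) 0.
have := hpt 0 b^-1; have := hpt 0 (- b^-1).
rewrite !hE sqV sqNV expr0n /= !add0r !addr0.
move=> /(_ erefl) e1 /(_ erefl) e2 /(_ erefl) e3 /(_ erefl) e4.
have h2 : v (inord 2) 0 = v (inord 1) 0 * z 0 (inord 0).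
  apply/eqP; rewrite -subr_eq0 -(mulrI_eq0 _ (lregP r0)); apply/eqP; lra.
have h3 : v (inord 3) 0 = v (inord 1) 0 * z 0 (inord 1).
  apply/eqP; rewrite -subr_eq0 -(mulrI_eq0 _ (lregP r0)); apply/eqP; lra.
have h0 : v (inord 0) 0 = v (inord 1) 0 * (normsq z - b ^- 2).
  by move: e1; rewrite h2 h3 -sqV /normsq dotvE; lra.
(* The interior point used is the centre if [b > 0] and infinity if [b < 0]. *)
have sgn : 0 < b * v (inord 1) 0.
  have bV2 : 0 < b ^- 2 by rewrite invr_gt0 exprn_even_gt0.
  case: (ltrP 0 b) => [bp|bn].
    have /hi : inside (Circle z b0) (Some z).
      by rewrite /= bp /= subrr /normsq dotvE !mxE mul0r addr0.
    rewrite formE !vec4E h0 h2 h3 pmulr_rgt0 //.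
    rewrite (_ : _ - _ = b ^- 2 / 2 * v (inord 1) 0); last first.
      by rewrite /normsq dotvE; field.
    by rewrite pmulr_rgt0 ?divr_gt0.
  have /hi : inside (Circle z b0) None by rewrite /= ltNge bn.
  rewrite form_infty => v1; rewrite nmulr_rgt0 ?lt_neqAle ?b0 //; lra.
have vb : v (inord 1) 0 ^+ 2 / b ^+ 2 = 1.
  by rewrite -hv formE h0 h2 h3 /normsq dotvE; field.
have : v (inord 1) 0 ^+ 2 = b ^+ 2.
  by rewrite -[RHS]mul1r -vb divfK ?expf_neq0.
move/eqP; rewrite eqf_sqr => /orP[/eqP->//|/eqP vE].
by move: sgn; rewrite vE mulrN -expr2 oppr_gt0 ltNge sqr_ge0.
Qed.

(** Every point on or inside [c'] is the image of one on or inside [c], so the isometry [M]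
    transports the conditions required by [curvature_unique]. *)
Lemma is_image_curvature g M c c' :
  lifts_to g M -> is_image g c c' ->
  curvature c' = (M *m circle_vec c) (inord 1) 0.
Proof.
move=> [hM gM] [hl hi]; apply: curvature_unique.
- by rewrite form_isometry // form_circle_circle.
- move=> y; rewrite hl => -[x /locus_form cx <-].
  by have [l l0 ->] := gM x; rewrite formZr form_isometry // cx mulr0.
- move=> y; rewrite hi => -[x /inside_form cx <-].
  by have [l l0 ->] := gM x; rewrite formZr form_isometry // mulr_gt0.
Qed.

(** The unit circle has vector [(-1, 1, 0, 0)], whose reflection swaps the first two entries; hence
    the curvature of the inverted circle is the first entry of [circle_vec c]. *)
Lemma aug_coordsE c v : aug_coords c v -> v = circle_vec c.
Proof.
case=> -[c' /(is_image_curvature (inversion_lifts _)) c'E v0] v1 v2 v3.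
apply/colP; elim/ord4_ind; rewrite !vec4E // v0 c'E reflectionE formE.
rewrite !mxE !inordK //= /normsq ?dotvE ?mxE;
  case: (c) => *; rewrite /= ?mxE; by field.
Qed.

End Lorentz.

Theorem theorem2p4 (R : realType) (m n : nat) (Pi : polyhedron R m n)
    (c : 'I_m -> ocircle R) (d : 'I_n -> ocircle R)
    (hcfg : polyhedral_configuration Pi c d)
    (C : 'M[R]_(4, m)) (hC : forall i, aug_coords (c i) (col i C))
    (Ct : 'M[R]_(m, 4)) (hCt : C *m Ct = 1%:M)
    (b : 'cV[R]_m) (hb : descartes_tuple c d b) :
  b^T *m Gtilde Ct *m b = 0.
Proof.
have [t [g /W_geom_lifts[M gM] gt] ->] := hb.
have -> : \col_i curvature (t i) = (row (inord 1) (M *m C))^T.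
  apply/colP => i; rewrite !mxE (is_image_curvature gM (gt i)).
  by rewrite -(aug_coordsE (hC i)) mxE; apply: eq_bigr => k _; rewrite mxE.
rewrite trmxK rowE /Gtilde invmx_Pmx !trmx_mul !mulmxA.
(* The product [C *m Ct] and its transpose both cancel, leaving [M *m Pinv *m M^T] between two basis
   vectors. *)
rewrite -(mulmxA _ C Ct) hCt mulmx1 -(mulmxA _ Ct^T) -trmx_mul hCt trmx1 mulmx1.
rewrite -(mulmxA _ M) -(mulmxA _ _ M^T) isometry_Pinv; last by case: gM.
(* What remains is the diagonal entry of [Pinv] at the curvature index 1, which is 0. *)
by apply/matrixP => i j; rewrite trmx_delta -rowE -colE !mxE !inordK.
Qed.
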